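(* Let $q$ be a prime power, $1\le k\le n/2$, and let $H$ be any subgroup with $SL(n,q)\le H\le GL(n,q)$. The proportion of elements of $H$ which are regular semisimple and fix a $k$-space is at most the proportion of elements in $S_n$ which fix a $k$-set. In fact, it is at most the proportion of elements in $S_n$ which fix a $k$-set and have at most $q-1$ fixed points.
   Context: An element of $GL(n,q)$ is regular semisimple if its characteristic polynomial is squarefree (equivalently, it has $n$ distinct eigenvalues over the algebraic closure). ''Fixes a $k$-space'' means leaves invariant some $k$-dimensional subspace of $\mathbb{F}_q^n$; ''fixes a $k$-set'' means leaves invariant some $k$-element subset of $\{1,\dots,n\}$. *)

(* Defs.v *)
From HB Require Import structures.
From mathcomp Require Import all_boot all_order all_algebra all_fingroup.
From mathcomp Require Import boolp.

Set Implicit Arguments.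
Unset Strict Implicit.
Unset Printing Implicit Defensive.

Import Order.TTheory GRing.Theory Num.Theory.
Local Open Scope ring_scope.

(* size d = 1 says that d is a nonzero constant, so 0 is not squarefree. *)
Definition squarefree_poly (F : fieldType) (p : {poly F}) : Prop :=
  forall d : {poly F}, d ^+ 2 %| p -> size d = 1%N.

(* {'GL_n[F]} consists of matrices of size n.-1.+1, which is n as soon as
   0 < n. *)
Definition SL (n : nat) (F : finFieldType) : {set {'GL_n[F]}} :=
  [set g : {'GL_n[F]} | \det (GLval g) == 1].

Definition regular_semisimple (n : nat) (F : finFieldType) (g : {'GL_n[F]}) :
  bool := `[< squarefree_poly (char_poly (GLval g)) >].

(* A k-space is the row space of a rank k matrix U; g acts on row vectors by
   right multiplication. *)
Definition fixes_kspace (n : nat) (F : finFieldType) (k : nat)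
  (g : {'GL_n[F]}) : bool :=
  [exists U : 'M[F]_n.-1.+1, (\rank U == k) && stablemx U (GLval g)].

Definition fixes_kset (n k : nat) (s : 'S_n) : bool :=
  [exists A : {set 'I_n}, (#|A| == k) && (s @: A == A)].

Definition fixed_points (n : nat) (s : 'S_n) : {set 'I_n} :=
  [set i | s i == i].

Definition proportion (T : finType) (A : {set T}) (P : pred T) : rat :=
  #|[set x in A | P x]|%:R / #|A|%:R.

(* Main.v *)
Require Import Defs.
From HB Require Import structures.
From mathcomp Require Import all_boot all_order all_algebra all_fingroup.
From mathcomp Require Import all_solvable all_field.
From mathcomp Require Import boolp.

Set Implicit Arguments.
Unset Strict Implicit.
Unset Printing Implicit Defensive.

Import Order.TTheory GRing.Theory Num.Theory.
Local Open Scope ring_scope.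

(* Let K be a finite extension of F in which all the polynomials that occur
   split, with the Frobenius y |-> y^q, and for w in S_n let T_w be the set
   of all n-tuples y of units of K with y_(w i) = y_i^q. An ordering x of
   the n distinct eigenvalues of a regular semisimple g lies in T_w for a
   unique w; there are n! orderings, a g-invariant k-space gives a
   w-invariant k-set, and the fixed points of w index distinct nonzero
   elements of F. So it suffices to bound, for each w, the number of pairs
   (g, x) with x in T_w by |H|. Let R be the matrix of Frobenius-compatible
   row eigenvectors of g; for y in T_w the matrix P = R^-1 diag(y) (x_i^j)
   is Frobenius-invariant, hence lies in GL(n,q), and (x, P) determines (g,
   x, y). Since prod x = det g lies in det H, this bounds (number of pairs)
   * |T_w| by the number of (x, P) in T_w x GL(n,q) with prod x in det H,
   which is at most |T_w| |H| because prod maps T_w onto the units of F. *)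

(** * Finite fields *)

(* A repeated root would be a common root of the minimal polynomial and of its
   derivative, but finite fields are perfect. *)
Lemma squarefree_separable (F : finFieldType) (p : {poly F}) :
  squarefree_poly p -> separable_poly p.
Proof.
move=> sqf_p; have p_neq0 : p != 0.
  by apply/eqP=> p0; have := sqf_p 0; rewrite p0 dvdp0 size_poly0 => /(_ isT).
apply/negP=> /negP nsep_p; have [L [rs Dp _]] := FinSplittingFieldFor p_neq0.
pose q r := map_poly (in_alg L) r.
have [a ap adp] : exists2 a, root (q p) a & root (q p^`()) a.
  have : q (gcdp p p^`()) %| \prod_(z <- rs) ('X - z%:P).
    by rewrite -(eqp_dvdr _ Dp) dvdp_map dvdp_gcdl.
  case/dvdp_prod_XsubC => mk; set s := mask mk rs => Dd.
  case: s Dd => [|a s] Dd.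
    move: nsep_p; rewrite separable_poly.unlock /coprimep.
    rewrite -(size_map_poly (in_alg L)).
    by rewrite (eqp_size Dd) big_nil size_poly1.
  have : root (q (gcdp p p^`())) a.
    by rewrite (eqp_root Dd) big_cons rootM root_XsubC eqxx.
  by rewrite /q gcdp_map root_gcd => /andP[]; exists a.
have /polyOver1P[m Dm] : minPoly 1 a \is a polyOver 1%VS by apply: minPolyOver.
have m_dvd r : root (q r) a -> m %| r.
  move=> ra; rewrite -(dvdp_map (in_alg L)) -Dm minPoly_dvdp //.
  by apply/polyOver1P; exists r.
have /dvdpP[h Dh] := m_dvd _ ap.
have sep_a : separable_element 1 a.
  have /and3P[_ /separableP sepL _] :=
    finField_galois (subvf (1%AS : {subfield L})).
  exact: sepL (memvf a).
have m'a : ~~ root (q m^`()) a.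
  by have := separable_root_der 1 a; rewrite sep_a /q -deriv_map -Dm.
(* Since p = h m and m(a) = 0, evaluating p' at [a] leaves h(a) m'(a), where m'(a) is nonzero. Hence
   [m] divides [h] too, and m^2 divides p. *)
have ha : root (q h) a.
  move: adp; rewrite /q Dh derivM rmorphD !rmorphM /= -Dm.
  rewrite /root hornerD !hornerM.
  by rewrite minPolyxx mulr0 add0r mulf_eq0 (negPf (m'a : ~~ (_ == 0))) orbF.
have m1 : size m = 1%N.
  by apply: sqf_p; rewrite Dh expr2; exact: dvdp_mul (m_dvd _ ha) (dvdpp m).
by have := size_minPoly 1%VS a; rewrite Dm size_map_poly m1.
Qed.

(** Over a finite field only finitely many polynomials have size at most [m]; a splitting field of
    the product of the nonzero ones splits them all at once. *)
Lemma finite_splitting_field (F : finFieldType) (m : nat) :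
  exists (K : finFieldType) (iota : {rmorphism F -> K}),
  forall p : {poly F}, p != 0 -> (size p <= m)%N ->
  exists rs, map_poly iota p %= \prod_(z <- rs) ('X - z%:P).
Proof.
pose P := \prod_(v : 'rV[F]_m | v != 0) rVpoly v.
have P_neq0 : P != 0.
  apply/prodf_neq0 => v; apply: contra_neq => v0.
  by rewrite -[v]rVpolyK v0 linear0.
have [L [rs DP _]] := FinSplittingFieldFor P_neq0.
exists (finvect_type L), (in_alg (finvect_type L)) => p p_neq0 size_p.
have pP : p %| P.
  rewrite /P (bigD1 (poly_rV p)) /= ?poly_rV_K ?dvdp_mulr //.
  by apply: contra_neq p_neq0 => p0; rewrite -(poly_rV_K size_p) p0 linear0.
have : map_poly (in_alg L) p %| \prod_(z <- rs) ('X - z%:P).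
  by rewrite -(eqp_dvdr _ DP) dvdp_map.
by case/dvdp_prod_XsubC => s; exists (mask s rs).
Qed.

(** The images of the elements of [F] are already q roots of X^q - X, so one more root would exceed
    its degree. *)
Lemma expf_card_fixed (F K : finFieldType) (iota : {rmorphism F -> K}) (y : K) :
  y ^+ #|F| = y -> exists c, y = iota c.
Proof.
move=> yq; pose s := [seq iota c | c <- enum F].
have [/mapP[c _ ->] | y_s] := boolP (y \in s); first by exists c.
have size_q : size ('X^#|F| - 'X : {poly K}) = #|F|.+1.
  rewrite size_polyDl ?size_polyN size_polyXn //.
  by rewrite size_polyX ltnS finNzRing_gt1.
suff : (size (y :: s) < size ('X^#|F| - 'X : {poly K})%R)%N.
  by rewrite size_q /= size_map -cardE ltnn.
apply: max_poly_roots.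
- by rewrite -size_poly_eq0 size_q.
- apply/allP => z; rewrite inE rootE !hornerE => /predU1P[->|/mapP[c _ ->]].
    by rewrite yq subrr.
  by rewrite -rmorphXn /= expf_card subrr.
- by rewrite /= y_s map_inj_uniq ?enum_uniq //; apply: fmorph_inj.
Qed.

(** The order of [F] is a power p^e of the characteristic, so the map is the e-fold iterate of y |->
    y^p. *)
Lemma expf_card_rmorphism (F K : finFieldType) (iota : {rmorphism F -> K}) :
  exists phi : {rmorphism K -> K}, forall y, phi y = y ^+ #|F|.
Proof.
have [p p_pr pF] := finPcharP F.
have pK : p \in [pchar K] by rewrite (fmorph_pchar iota).
have /abelem_pgroup := fin_ring_pchar_abelem pF; rewrite /pgroup cardsT.
case/p_natP => // e ->.
elim: e => [|e [phi Dphi]]; first by exists idfun => y; rewrite expn0 expr1.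
exists (pFrobenius_aut pK \o phi) => y.
by rewrite /= Dphi pFrobenius_autE -exprM expnSr.
Qed.

(** * Matrices of eigenvectors *)

(** The rows lie in eigenspaces for distinct values, whose sum is direct, so the nonzero rows are
    independent. *)
Lemma rank_eigenrows (K : fieldType) (n k : nat) (g : 'M[K]_k)
    (x : 'I_n -> K) (B : 'M[K]_(n, k)) :
  injective x -> (forall i, row i B *m g = x i *: row i B) ->
  \rank B = #|[set i | row i B != 0]|.
Proof.
move=> x_inj Bg; have sub_eig i : (<<row i B>> <= eigenspace g (x i))%MS.
  by rewrite genmxE; apply/eigenspaceP.
have dxB : mxdirect (\sum_i <<row i B>>).
  apply/mxdirect_sumsP => i _; apply/eqP; rewrite -submx0.
  have dxE : mxdirect (\sum_(i | true) eigenspace g (x i)).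
    by apply: mxdirect_sum_eigenspace => ? ? _ _ /x_inj.
  rewrite -[X in (_ <= X)%MS](mxdirect_sumsP dxE i isT) capmxS //.
  by apply/sumsmx_subP => j ji; rewrite (sumsmx_sup j).
have -> : \rank B = \rank (\sum_i <<row i B>>)%MS.
  apply: eqmx_rank; apply/andP; split.
    by apply/row_subP => i; apply: (sumsmx_sup i); rewrite ?genmxE.
  by apply/sumsmx_subP => i _; rewrite genmxE row_sub.
rewrite (mxdirectP dxB) /= cardsE -sum1_card [RHS]big_mkcond.
by apply: eq_bigr => i _; rewrite genmxE rank_rV unfold_in; case: eqP.
Qed.

Lemma map_nz_row (K L : fieldType) (f : {rmorphism K -> L}) (m n : nat)
    (A : 'M[K]_(m, n)) :
  map_mx f (nz_row A) = nz_row (map_mx f A).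
Proof.
rewrite /nz_row.
under [in RHS]eq_pick => i do rewrite -map_row map_mx_eq0.
by case: pickP => [i _ | _] /=; rewrite ?map_row ?map_mx0.
Qed.

(** Arbitrary eigenvectors would not do: [eigenspace] and [nz_row] commute with field morphisms, so
    the Frobenius carries the vector chosen for an eigenvalue exactly to the one chosen for its
    image. *)
Definition eigenrows (K : fieldType) (n : nat) (g : 'M[K]_n) (x : 'I_n -> K) :
    'M[K]_n :=
  \matrix_i nz_row (eigenspace g (x i)).

Lemma eigenrowsP (K : fieldType) (n : nat) (g : 'M[K]_n) (x : 'I_n -> K) i :
  row i (eigenrows g x) *m g = x i *: row i (eigenrows g x).
Proof. by apply/eigenspaceP; rewrite rowK nz_row_sub. Qed.

Lemma row_diag_mul (R : pzSemiRingType) (n k : nat) (d : 'rV[R]_n)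
    (A : 'M[R]_(n, k)) i :
  row i (diag_mx d *m A) = d 0 i *: row i A.
Proof. by apply/rowP => j; rewrite mul_diag_mx !mxE. Qed.

Lemma eigenrows_mul (K : fieldType) (n : nat) (g : 'M[K]_n) (x : 'I_n -> K) :
  eigenrows g x *m g = diag_mx (\row_i x i) *m eigenrows g x.
Proof.
by apply/row_matrixP => i; rewrite row_mul eigenrowsP row_diag_mul !mxE.
Qed.

Lemma eigenrows_unit (K : fieldType) (n : nat) (g : 'M[K]_n) (x : 'I_n -> K) :
  injective x -> (forall i, eigenvalue g (x i)) -> eigenrows g x \in unitmx.
Proof.
move=> x_inj gx; rewrite -row_free_unit /row_free.
rewrite (rank_eigenrows x_inj (eigenrowsP g x)) -[X in _ == X]card_ord.
rewrite (_ : [set i | _] = setT) ?cardsT //.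
by apply/setP => i; rewrite !inE rowK nz_row_eq0; apply: gx.
Qed.

Lemma det_eigenvalues (K : fieldType) (n : nat) (g : 'M[K]_n) (x : 'I_n -> K) :
  injective x -> (forall i, eigenvalue g (x i)) -> \det g = \prod_i x i.
Proof.
move=> x_inj gx; have := eigenrows_unit x_inj gx.
rewrite unitmxE unitfE => R_neq0; apply: (mulfI R_neq0).
rewrite -det_mulmx eigenrows_mul det_mulmx mulrC det_diag.
by congr (_ * _); apply: eq_bigr => i _; rewrite mxE.
Qed.

Lemma map_eigenrows (K : fieldType) (n : nat) (phi : {rmorphism K -> K})
    (g : 'M[K]_n) (x : 'I_n -> K) (w : 'S_n) :
  map_mx phi g = g -> (forall i, phi (x i) = x (w i)) ->
  map_mx phi (eigenrows g x) = row_perm w (eigenrows g x).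
Proof.
move=> phig phix; apply/row_matrixP => i.
have -> : row i (row_perm w (eigenrows g x)) = row (w i) (eigenrows g x).
  by apply/rowP => j; rewrite !mxE.
by rewrite -map_row !rowK map_nz_row map_eigenspace phig phix.
Qed.

(** A Vandermonde matrix: it depends on [x] alone, is invertible for distinct entries, and has its
    rows permuted by the Frobenius just as the eigenrows are. *)
Definition power_rows (K : fieldType) (n : nat) (x : 'I_n -> K) : 'M[K]_n :=
  \matrix_(i, j) x i ^+ j.

Lemma power_rows_unit (K : fieldType) (n : nat) (x : 'I_n -> K) :
  injective x -> power_rows x \in unitmx.
Proof.
move=> x_inj; rewrite -unitmx_tr unitmxE unitfE.
have -> : (power_rows x)^T = Vandermonde n (\row_i x i).
  by apply/matrixP => i j; rewrite !mxE.
rewrite det_Vandermonde; apply/prodf_neq0 => i _; apply/prodf_neq0 => j ij.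
rewrite !mxE subr_eq0; by apply: contraTneq ij => /x_inj->; rewrite ltnn.
Qed.

Lemma map_power_rows (K : fieldType) (n : nat) (phi : {rmorphism K -> K})
    (x : 'I_n -> K) (w : 'S_n) :
  (forall i, phi (x i) = x (w i)) ->
  map_mx phi (power_rows x) = row_perm w (power_rows x).
Proof.
by move=> phix; apply/matrixP => i j; rewrite !mxE rmorphXn /= phix.
Qed.

Lemma map_diag_mul (K : fieldType) (n k : nat) (phi : {rmorphism K -> K})
    (y : 'I_n -> K) (w : 'S_n) (A : 'M[K]_(n, k)) :
  (forall i, phi (y i) = y (w i)) -> map_mx phi A = row_perm w A ->
  map_mx phi (diag_mx (\row_i y i) *m A) =
    row_perm w (diag_mx (\row_i y i) *m A).
Proof.
move=> phiy /matrixP phiA; apply/matrixP => i j.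
rewrite !mul_diag_mx !mxE rmorphM /= phiy.
by have := phiA i j; rewrite !mxE => ->.
Qed.

(** The Frobenius multiplies both matrices on the left by the same permutation matrix, which cancels
    in the quotient. *)
Lemma map_invmx_mul (K : fieldType) (n k : nat) (phi : {rmorphism K -> K})
    (w : 'S_n) (A : 'M[K]_n) (B : 'M[K]_(n, k)) :
  A \in unitmx -> map_mx phi A = row_perm w A -> map_mx phi B = row_perm w B ->
  map_mx phi (invmx A *m B) = invmx A *m B.
Proof.
move=> uA phiA phiB.
have uphiA : map_mx phi A \in unitmx by rewrite map_unitmx.
rewrite map_mxM map_invmx; apply: (can_inj (mulKmx uphiA)).
by rewrite mulKVmx // phiA phiB !row_permE -mulmxA mulKVmx.
Qed.

(* The columns of U R^-1, for R the matrix of eigenrows of g, are zero or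
   eigenvectors of the restriction of g to U. *)
Lemma stable_support (K : fieldType) (n k : nat) (U : 'M[K]_(k, n))
    (g : 'M[K]_n) (x : 'I_n -> K) :
  injective x -> (forall i, eigenvalue g (x i)) -> row_free U -> stablemx U g ->
  #|[set i | col i (U *m invmx (eigenrows g x)) != 0]| = k.
Proof.
move=> x_inj gx freeU /submxP[M UgE]; have uR := eigenrows_unit x_inj gx.
set C := U *m _.
have rankC : \rank C^T = k.
  rewrite mxrank_tr mxrankMfree ?row_free_unit ?unitmx_inv //.
  exact/eqP.
rewrite -[RHS]rankC (@rank_eigenrows _ _ _ M^T x) //.
  by apply: eq_card => i; rewrite !inE -tr_col trmx_eq0.
have CD : M *m C = C *m diag_mx (\row_i x i).
  rewrite /C mulmxA -UgE -!mulmxA; congr (_ *m _).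
  apply: (can_inj (mulKmx uR)); rewrite mulmxA eigenrows_mul -mulmxA mulmxV //.
  by rewrite mulmx1 mulKVmx.
move=> i; rewrite -row_mul -trmx_mul CD trmx_mul tr_diag_mx row_diag_mul.
by rewrite mxE.
Qed.

(** * Counting with maximal tori *)

(** Choosing a related [b] for each [a] gives an injection. The relational form serves the cases
    where an image is only known to exist. *)
Lemma leq_card_rel (S T : finType) (A : {set S}) (B : {set T})
    (r : S -> T -> bool) :
  (forall a, a \in A -> exists2 b, b \in B & r a b) ->
  (forall a a' b, a \in A -> a' \in A -> r a b -> r a' b -> a = a') ->
  (#|A| <= #|B|)%N.
Proof.
move=> r_tot r_inj; have [->|[a0 /r_tot[b0 _ _]]] := set_0Vmem A.
  by rewrite cards0.
have [f fP] : exists f : S -> T, forall a, a \in A -> f a \in B /\ r a (f a).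
  apply: (@fin_all_exists S (fun=> T) (fun a b => a \in A -> b \in B /\ r a b)).
  move=> a; have [/r_tot[b bB rab]|_] := boolP (a \in A); first by exists b.
  by exists b0.
have f_inj : {in A &, injective f}.
  move=> a a' Aa Aa' fa; have [_ raf] := fP _ Aa; have [_ ra'f] := fP _ Aa'.
  by apply: r_inj raf _; rewrite // fa.
rewrite -(card_in_imset f_inj) subset_leq_card //.
by apply/subsetP => _ /imsetP[a /fP[fB _] ->].
Qed.

Lemma SL_det_mem (F : finFieldType) (n : nat) (H : {group {'GL_n[F]}})
    (g h : {'GL_n[F]}) :
  SL n F \subset H -> h \in H -> \det (GLval g) = \det (GLval h) -> g \in H.
Proof.
move=> /subsetP SLH hH gh; rewrite -[g](mulgKV h) groupM // SLH // inE.
by rewrite GL_ME GL_VE det_mulmx det_inv gh mulfV ?GL_det.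
Qed.

Lemma GL_det_onto (F : finFieldType) (n : nat) (c : F) :
  c != 0 -> exists g : {'GL_n[F]}, \det (GLval g) = c.
Proof.
move=> c0; pose d : 'rV[F]_n.-1.+1 := \row_i (if i == ord0 then c else 1).
have det_d : \det (diag_mx d) = c.
  rewrite det_diag (bigD1 ord0) //= mxE eqxx big1 ?mulr1 // => i /negPf i0.
  by rewrite mxE i0.
have ud : diag_mx d \is a GRing.unit by rewrite unitmxE det_d unitfE.
by exists (Sub (diag_mx d) ud).
Qed.

Section FrobeniusType.

Variables (F K : finFieldType) (iota : {rmorphism F -> K}).
Variable phi : {rmorphism K -> K}.
Hypothesis phiE : forall y, phi y = y ^+ #|F|.

Lemma phi_iota c : phi (iota c) = iota c.
Proof. by rewrite phiE -rmorphXn /= expf_card. Qed.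

Lemma map_phi_iota (m n : nat) (A : 'M[F]_(m, n)) :
  map_mx phi (map_mx iota A) = map_mx iota A.
Proof. by apply/matrixP => i j; rewrite !mxE phi_iota. Qed.

Lemma phi_fixed_mx (m n : nat) (A : 'M[K]_(m, n)) :
  map_mx phi A = A -> exists B : 'M[F]_(m, n), A = map_mx iota B.
Proof.
move=> /matrixP phiA.
have cP ij : exists c, A ij.1 ij.2 = iota c.
  by apply: expf_card_fixed; rewrite -phiE; have := phiA ij.1 ij.2; rewrite mxE.
have [c Dc] := fin_all_exists cP.
exists (\matrix_(i, j) c (i, j)); apply/matrixP => i j.
by rewrite !mxE -[LHS]/(A (i, j).1 (i, j).2) Dc.
Qed.

(* The rational points of a maximal torus of type w, diagonalised over K. *)
Definition torus (n : nat) (w : 'S_n) : {set {ffun 'I_n -> K}} :=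
  [set y : {ffun 'I_n -> K} | [forall i, (y i != 0) && (phi (y i) == y (w i))]].

Lemma torusP (n : nat) (w : 'S_n) (y : {ffun 'I_n -> K}) :
  reflect (forall i, y i != 0 /\ phi (y i) = y (w i)) (y \in torus w).
Proof.
rewrite inE; apply: (iffP forallP) => yw i.
  by case/andP: (yw i) => ? /eqP.
by have [-> ->] := yw i; rewrite eqxx.
Qed.

Lemma torus_mul (n : nat) (w : 'S_n) (y z : {ffun 'I_n -> K}) :
  y \in torus w -> z \in torus w -> [ffun i => y i * z i] \in torus w.
Proof.
move=> /torusP yw /torusP zw; apply/torusP => i; rewrite !ffunE rmorphM.
by have [y0 ->] := yw i; have [z0 ->] := zw i; rewrite mulf_neq0.
Qed.

Lemma torus_gt0 (n : nat) (w : 'S_n) : (0 < #|torus w|)%N.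
Proof.
apply/card_gt0P; exists [ffun=> 1]; apply/torusP => i.
by rewrite !ffunE oner_neq0 rmorph1.
Qed.

(** The Frobenius permutes the factors, so it fixes the product. *)
Lemma torus_norm (n : nat) (w : 'S_n) (y : {ffun 'I_n -> K}) :
  y \in torus w -> exists2 c, c != 0 & \prod_i y i = iota c.
Proof.
move=> /torusP yw; have [c Dc] : exists c, \prod_i y i = iota c.
  apply: expf_card_fixed; rewrite -phiE rmorph_prod /=.
  under eq_bigr => i _ do rewrite (proj2 (yw i)).
  by rewrite [RHS](reindex_inj (@perm_inj _ w)).
exists c => //; rewrite -(fmorph_eq0 iota) -Dc.
by apply/prodf_neq0 => i _; case: (yw i).
Qed.

Definition ordered_spectrum (n : nat) (g : 'M[F]_n) (x : {ffun 'I_n -> K}) :=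
  injectiveb x && [forall i, eigenvalue (map_mx iota g) (x i)].

Lemma ordered_spectrumP (n : nat) (g : 'M[F]_n) (x : {ffun 'I_n -> K}) :
  reflect (injective x /\ forall i, eigenvalue (map_mx iota g) (x i))
    (ordered_spectrum g x).
Proof.
apply: (iffP andP) => -[x_inj gx]; split; try exact/injectiveP.
  exact/forallP.
exact/forallP.
Qed.

(* The Frobenius permutes the rows of (x_i^j) as it does the eigenrows of g and
   the entries of y, so the three permutations cancel in the product. *)
Definition torus_conj (n : nat) (g : 'M[F]_n) (x y : {ffun 'I_n -> K}) :=
  invmx (eigenrows (map_mx iota g) x) *m
    (diag_mx (\row_i y i) *m power_rows x).

Lemma torus_conj_descent (n : nat) (w : 'S_n) (g : 'M[F]_n)
    (x y : {ffun 'I_n -> K}) :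
  ordered_spectrum g x -> x \in torus w -> y \in torus w ->
  exists2 P : 'M[F]_n, P \in unitmx & torus_conj g x y = map_mx iota P.
Proof.
move=> /ordered_spectrumP[x_inj gx] /torusP xw /torusP yw.
have uR := eigenrows_unit x_inj gx; have uW := power_rows_unit x_inj.
have phix i : phi (x i) = x (w i) by case: (xw i).
have phiy i : phi (y i) = y (w i) by case: (yw i).
have [P DP] : exists P : 'M[F]_n, torus_conj g x y = map_mx iota P.
  apply: phi_fixed_mx; apply: (map_invmx_mul uR).
    by apply: map_eigenrows; rewrite ?map_phi_iota.
  by apply: map_diag_mul => //; apply: map_power_rows.
exists P => //; rewrite -(map_unitmx iota) -DP !unitmx_mul unitmx_inv uR uW.
rewrite andbT unitmxE det_diag unitfE; apply/prodf_neq0 => i _; rewrite mxE.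
by case: (yw i).
Qed.

(** Cancelling the Vandermonde factor leaves Q = R^-1 diag(y), whose columns are eigenvectors of
    [g]. So g = Q diag(x) Q^-1 is determined by Q and [x]; then R is known, and with it [y]. *)
Lemma torus_conj_inj (n : nat) (g h : 'M[F]_n) (x y z : {ffun 'I_n -> K}) :
  ordered_spectrum g x -> ordered_spectrum h x -> (forall i, y i != 0) ->
  torus_conj g x y = torus_conj h x z -> g = h /\ y = z.
Proof.
move=> /ordered_spectrumP[x_inj gx] /ordered_spectrumP[_ hx] y0 E.
have uW := power_rows_unit x_inj.
have uRg := eigenrows_unit x_inj gx; have uRh := eigenrows_unit x_inj hx.
pose Q (f : 'M[F]_n) (v : {ffun 'I_n -> K}) :=
  invmx (eigenrows (map_mx iota f) x) *m diag_mx (\row_i v i).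
have EQ : Q g y = Q h z.
  by apply: (can_inj (mulmxK uW)); rewrite /Q -!mulmxA.
have uQ : Q g y \in unitmx.
  rewrite unitmx_mul unitmx_inv uRg unitmxE det_diag unitfE.
  by apply/prodf_neq0 => i _; rewrite mxE.
have fQ f v : eigenrows (map_mx iota f) x \in unitmx ->
    map_mx iota f *m Q f v = Q f v *m diag_mx (\row_i x i).
  move=> uR; apply: (can_inj (mulKmx uR)).
  rewrite mulmxA eigenrows_mul /Q !mulmxA mulmxV // mul1mx mulmxK //.
  exact: diag_mxC.
have gh : g = h.
  apply: (map_mx_inj (f := iota)); apply: (can_inj (mulmxK uQ)).
  by rewrite fQ // EQ fQ.
have uRg' : invmx (eigenrows (map_mx iota g) x) \in unitmx.
  by rewrite unitmx_inv.
split=> //; have : diag_mx (\row_i y i) = diag_mx (\row_i z i).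
  by apply: (can_inj (mulKmx uRg')); move: EQ; rewrite /Q -gh.
move=> /matrixP D; apply/ffunP => i; have := D i i.
by rewrite !mxE eqxx.
Qed.

(* The norm from the field with q^d elements is t |-> t^e with
   e = 1 + q + ... + q^(d-1); a root t of X^e - c is automatically fixed by the
   d-th power of the Frobenius because (q-1)e = q^d - 1. *)
Lemma torus_norm_onto (n : nat) (w : 'S_n) (i0 : 'I_n) (c : F) :
  c != 0 ->
  (forall e, (0 < e)%N -> (e <= #|F| ^ n)%N -> exists t, t ^+ e = iota c) ->
  exists2 z, z \in torus w & \prod_i z i = iota c.
Proof.
move=> c0 c_root; pose q := #|F|; pose d := fingraph.order w i0.
pose e := (\sum_(j < d) q ^ j)%N.
have q_gt1 : (1 < q)%N := finNzRing_gt1 F.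
have d_gt0 : (0 < d)%N by apply: fingraph.order_gt0.
have qd : (q ^ d = (q.-1 * e).+1)%N.
  by rewrite -predn_exp prednK ?expn_gt0 ?(ltnW q_gt1).
have e_gt0 : (0 < e)%N by rewrite /e -(prednK d_gt0) big_ord_recl.
have [t te] : exists t, t ^+ e = iota c.
  apply: c_root => //; apply: (@leq_trans (q ^ d)).
    by rewrite qd leqW // leq_pmull // -subn1 subn_gt0.
  rewrite leq_exp2l //; by rewrite (leq_trans (max_card _)) ?card_ord.
have t0 : t != 0.
  apply: contraNneq c0 => t0; rewrite -(fmorph_eq0 iota) -te t0.
  by rewrite expr0n eqn0Ngt e_gt0.
have tq : t ^+ (q ^ d) = t.
  rewrite qd exprS mulnC exprM te -rmorphXn /=.
  suff -> : c ^+ q.-1 = 1 by rewrite rmorph1 mulr1.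
  by apply: (mulfI c0); rewrite -exprS prednK ?(ltnW q_gt1) // mulr1 expf_card.
pose O := fingraph.orbit w i0.
(* The conjugates of [t] are laid out along the cycle of [i0], with 1 elsewhere, so the product of
   all entries is t^e. *)
pose z := [ffun i => if i \in O then t ^+ (q ^ findex w i0 i) else 1].
have zE j : (j < d)%N -> z (iter j w i0) = t ^+ (q ^ j).
  by move=> jd; rewrite ffunE -fconnect_orbit fconnect_iter findex_iter.
exists z.
  apply/torusP => i; rewrite phiE; have [wi|wi] := boolP (i \in O).
    have jd : (findex w i0 i < d)%N.
      by apply: findex_max; rewrite fconnect_orbit.
    have Di : iter (findex w i0 i) w i0 = i.
      by apply: iter_findex; rewrite fconnect_orbit.
    move: jd Di; set j := findex _ _ _ => jd <-.
    rewrite zE // expf_neq0 //; split=> //; rewrite -exprM -expnSr.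
    rewrite -[w _]/(iter j.+1 w i0); have [jd'|] := ltnP j.+1 d.
      by rewrite zE.
    (* At the last point of the cycle [w] returns to [i0], and t^(q^d) = t closes the pattern. *)
    rewrite leq_eqVlt ltnNge jd orbF => /eqP <-.
    rewrite (iter_order (@perm_inj _ w)) tq.
    by rewrite -[i0 in RHS]/(iter 0 w i0) zE // expn0 expr1.
  have wwi : w i \notin O.
    apply: contra wi; rewrite -!fconnect_orbit => wi.
    apply: connect_trans wi _; rewrite fconnect_sym; last exact: perm_inj.
    exact: fconnect1.
  by rewrite !ffunE (negPf wi) (negPf wwi) expr1n oner_neq0.
rewrite (bigID (mem O)) /= [X in _ * X]big1 ?mulr1; last first.
  by move=> i /negPf wi; rewrite ffunE wi.
rewrite -big_uniq ?orbit_uniq //= (big_nth i0) size_orbit -te /e expr_sum.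
rewrite big_mkord; apply: eq_bigr => j _.
by rewrite nth_traject // zE.
Qed.

(** As [g] is defined over [F], the Frobenius sends eigenvalues to eigenvalues. The n distinct
    entries of [x] exhaust the roots of the characteristic polynomial, so they are permuted. *)
Lemma spectrum_perm (n : nat) (g : 'M[F]_n) (x : {ffun 'I_n -> K}) :
  g \in unitmx -> ordered_spectrum g x -> exists w : 'S_n, x \in torus w.
Proof.
move=> ug /ordered_spectrumP[x_inj gx].
have x_onto y : eigenvalue (map_mx iota g) y -> exists i, y = x i.
  move=> gy; have [/mapP[i _ ->]|y_x] := boolP (y \in codom x).
    by exists i.
  suff : (size (y :: codom x) < size (char_poly (map_mx iota g)))%N.
    by rewrite size_char_poly /= size_codom card_ord ltnn.
  apply: max_poly_roots; rewrite ?monic_neq0 ?char_poly_monic //.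
    apply/allP => a; rewrite inE -eigenvalue_root_char.
    by case/predU1P => [->|/codomP[i ->]].
  by rewrite /= y_x; apply/injectiveP.
have wP i : exists j, phi (x i) = x j.
  by apply: x_onto; rewrite -map_phi_iota eigenvalue_map.
have [w Dw] := fin_all_exists wP.
have w_inj : injective w.
  by move=> i j wij; apply: x_inj; apply: (fmorph_inj phi); rewrite !Dw wij.
exists (perm w_inj); apply/torusP => i; rewrite Dw permE; split=> //.
have : \det (map_mx iota g) != 0 by rewrite -unitfE -unitmxE map_unitmx.
by rewrite (det_eigenvalues x_inj gx) => /prodf_neq0/(_ i isT).
Qed.

Lemma ordered_spectrum_perm (n : nat) (g : 'M[F]_n) (x : {ffun 'I_n -> K})
    (s : 'S_n) :
  ordered_spectrum g x -> ordered_spectrum g [ffun i => x (s i)].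
Proof.
move=> /ordered_spectrumP[x_inj gx]; apply/ordered_spectrumP; split=> [i j|i].
  by rewrite !ffunE => /x_inj/perm_inj.
by rewrite ffunE.
Qed.

Lemma ordered_spectrum_exists (n : nat) (g : 'M[F]_n) (rs : seq K) :
  squarefree_poly (char_poly g) ->
  map_poly iota (char_poly g) %= \prod_(z <- rs) ('X - z%:P) ->
  exists x, ordered_spectrum g x.
Proof.
move=> /squarefree_separable sep_g; rewrite map_char_poly => Dg.
have rs_uniq : uniq rs.
  rewrite -separable_prod_XsubC -(eqp_separable Dg) -map_char_poly.
  by rewrite separable_map.
have size_rs : size rs = n.
  apply: succn_inj; rewrite -(size_char_poly (map_mx iota g)) (eqp_size Dg).
  by rewrite size_prod_XsubC.
exists [ffun i : 'I_n => nth 0 rs i]; apply/ordered_spectrumP; split.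
  move=> i j; rewrite !ffunE => /eqP; rewrite nth_uniq ?size_rs //.
  by move=> /eqP/val_inj.
move=> i; rewrite ffunE eigenvalue_root_char (eqp_root Dg) root_prod_XsubC.
by rewrite mem_nth // size_rs.
Qed.

Lemma torus_fixed_points (n : nat) (w : 'S_n) (x : {ffun 'I_n -> K}) :
  injective x -> x \in torus w -> (#|fixed_points w| <= #|F| - 1)%N.
Proof.
move=> x_inj /torusP xw.
have -> : (#|F| - 1 = #|[set c : F | c != 0%R]|)%N.
  by rewrite subn1 -(cardC1 (0 : F)) cardsE; apply: eq_card => c; rewrite !inE.
apply: (@leq_card_rel _ _ _ _ (fun i c => x i == iota c)).
  move=> i; rewrite inE => /eqP wi; have [x0] := xw i; rewrite wi phiE => xq.
  have [c Dc] := expf_card_fixed iota xq; exists c; last exact/eqP.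
  by rewrite inE -(fmorph_eq0 iota) -Dc.
by move=> i j c _ _ /eqP xi /eqP xj; apply: x_inj; rewrite xi xj.
Qed.

(** The invariant set consists of the indices of the eigenvectors that occur in [U], that is, of the
    nonzero columns of C = U R^-1. *)
Lemma torus_fixes_kset (n k : nat) (U : 'M[F]_(k, n)) (g : 'M[F]_n) (w : 'S_n)
    (x : {ffun 'I_n -> K}) :
  ordered_spectrum g x -> x \in torus w ->
  row_free U -> stablemx U g -> fixes_kset k w.
Proof.
move=> /ordered_spectrumP[x_inj gx] /torusP xw freeU Ug.
pose UK := map_mx iota U; pose R := eigenrows (map_mx iota g) x.
pose A := [set i | col i (UK *m invmx R) != 0].
apply/existsP; exists A; rewrite stable_support ?eqxx //=; last first.
- by rewrite -map_mxM map_submx.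
- by rewrite row_free_map.
have phiR : map_mx phi R = row_perm w R.
  apply: map_eigenrows; first exact: map_phi_iota.
  by move=> i; case: (xw i).
have uR : R \in unitmx by apply: eigenrows_unit.
(* Applying the Frobenius to U = C R fixes U and permutes the rows of R, so it must permute the
   columns of C by [w]; the support of C is therefore [w]-stable. *)
have phiC : map_mx phi (UK *m invmx R) *m perm_mx w = UK *m invmx R.
  apply: (can_inj (mulmxK uR)); rewrite -[LHS]mulmxA -row_permE -phiR.
  rewrite -map_mxM -mulmxA mulVmx // mulmx1.
  exact: map_phi_iota.
have CE r i : (UK *m invmx R) r (w i) = phi ((UK *m invmx R) r i).
  rewrite -[in LHS]phiC -{1}[w]invgK -col_permE.
  by rewrite [LHS]mxE permK [LHS]mxE.
rewrite eqEcard card_imset ?leqnn ?andbT; last exact: perm_inj.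
apply/subsetP => _ /imsetP[i iA ->]; move: iA; rewrite !inE.
apply: contraNneq => /matrixP wi; apply/eqP/matrixP => r j.
rewrite ord1 [LHS]mxE; apply: (fmorph_inj phi); have := wi r 0.
by rewrite [LHS]mxE CE => ->; rewrite !mxE rmorph0.
Qed.

(* Twisting x and P by elements of norm b/a and determinant a/b, where
   a = prod x and b = det P, exchanges the norm of x and the determinant
   of P. *)
Lemma torus_norm_coset_bound (n : nat) (H : {group {'GL_n.+1[F]}})
    (w : 'S_n.+1) :
  SL n.+1 F \subset H ->
  (forall e, (0 < e)%N -> (e <= #|F| ^ n.+1)%N ->
    forall c, exists t, t ^+ e = iota c) ->
  (#|[set xP : {ffun 'I_n.+1 -> K} * {'GL_n.+1[F]} |
      (xP.1 \in torus w) &&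
      [exists h in H, (\prod_i xP.1 i == iota (\det (GLval h)))%R]]|
    <= #|torus w| * #|H|)%N.
Proof.
move=> SLH c_root; rewrite -cardsX.
(* Guarding by c != 0 inside the existential allows a choice for every [c]; the value at 0 is a
   dummy. *)
have zP c : exists z : {ffun 'I_n.+1 -> K},
    c != 0 -> z \in torus w /\ \prod_i z i = iota c.
  have [->|c0] := eqVneq c 0; first by exists [ffun=> 0].
  have [|z zw Dz] := torus_norm_onto w ord0 c0.
    by move=> e e_gt0 le_e; apply: c_root.
  by exists z.
have [z Dz] := fin_all_exists zP.
have uP c : exists u : {'GL_n.+1[F]}, c != 0 -> \det (GLval u) = c.
  have [->|c0] := eqVneq c 0; first by exists 1%g.
  by have [u Du] := GL_det_onto n.+1 c0; exists u.
have [u Du] := fin_all_exists uP.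
pose mulf (x y : {ffun 'I_n.+1 -> K}) : {ffun 'I_n.+1 -> K} :=
  [ffun i => x i * y i].
have prod_mulf x y : \prod_i mulf x y i = (\prod_i x i) * \prod_i y i.
  by rewrite -big_split; apply: eq_bigr => i _; rewrite ffunE.
pose r (xP yQ : {ffun 'I_n.+1 -> K} * {'GL_n.+1[F]}) :=
  [exists a : F, (\prod_i xP.1 i == iota a) &&
    let b := \det (GLval xP.2) in
    (yQ == (mulf xP.1 (z (b / a)), (xP.2 * u (a / b)%R)%g))].
apply: (@leq_card_rel _ _ _ _ r).
  case=> x P /=; rewrite inE /= => /andP[xw /exists_inP[h hH /eqP Dx]].
  pose a := \det (GLval h); pose b := \det (GLval P).
  have a0 : a != 0 by apply: GL_det.
  have b0 : b != 0 by apply: GL_det.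
  exists (mulf x (z (b / a)), (P * u (a / b)%R)%g); last first.
    by apply/existsP; exists a; rewrite /= Dx !eqxx.
  rewrite inE /=; apply/andP; split.
    apply: torus_mul => //; have [] // := Dz (b / a).
    by rewrite mulf_neq0 ?invr_eq0.
  (* The twisted matrix has determinant b (a/b) = a, the determinant of [h], which puts it in
     [H]. *)
  apply: (SL_det_mem SLH hH); rewrite GL_ME det_mulmx Du.
    by rewrite mulrC divfK.
  by rewrite mulf_neq0 ?invr_eq0.
(* Both a and b can be read off the image, as its determinant and its norm, so the twists are known
   and can be undone. *)
have rP x P yQ : x \in torus w -> r (x, P) yQ ->
    let a := \det (GLval yQ.2) in let b := \det (GLval P) in
    [/\ a != 0, b != 0, \prod_i yQ.1 i = iota b &
      yQ = (mulf x (z (b / a)), (P * u (a / b)%R)%g)].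
  move=> xw /existsP[a /andP[/eqP /= Dx /eqP]]; set b := \det (GLval P) => ->.
  have b0 : b != 0 by apply: GL_det.
  have a0 : a != 0.
    by have [a' a'0] := torus_norm xw; rewrite Dx => /(fmorph_inj iota)->.
  have [ab0 ba0] : a / b != 0 /\ b / a != 0 by rewrite !mulf_neq0 ?invr_eq0.
  have Da : \det (GLval (P * u (a / b)%R)%g) = a.
    by rewrite GL_ME det_mulmx Du // mulrC divfK.
  rewrite /= Da; split=> //; rewrite prod_mulf Dx (proj2 (Dz _ ba0)) -rmorphM.
  by rewrite mulrC divfK.
case=> [x P] [x' P'] yQ; rewrite inE => /andP[/= xw _].
rewrite inE => /andP[/= xw' _].
move=> /(rP _ _ _ xw)[a0 b0 Db DyQ] /(rP _ _ _ xw')[_ _].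
rewrite Db => /(fmorph_inj iota) Dbb; rewrite -Dbb [LHS]DyQ => E.
have <- := mulIg _ _ _ (congr1 snd E); have Dx := congr1 fst E.
congr (_, _); apply/ffunP => i.
have := congr1 (fun f : {ffun 'I_n.+1 -> K} => f i) Dx.
rewrite !ffunE; apply: mulIf.
have [|/torusP zw _] := Dz (\det (GLval P) / \det (GLval yQ.2)).
  by rewrite mulf_neq0 ?invr_eq0.
by case: (zw i).
Qed.

Lemma spectrum_count_bound (n : nat) (H : {group {'GL_n.+1[F]}})
    (A : {set {'GL_n.+1[F]}}) (w : 'S_n.+1) :
  SL n.+1 F \subset H -> A \subset H ->
  (forall e, (0 < e)%N -> (e <= #|F| ^ n.+1)%N ->
    forall c, exists t, t ^+ e = iota c) ->
  (#|[set gx : {'GL_n.+1[F]} * {ffun 'I_n.+1 -> K} |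
      [&& gx.1 \in A, ordered_spectrum (GLval gx.1) gx.2 &
          gx.2 \in torus w]]| <= #|H|)%N.
Proof.
(* Multiplying by the order of the torus turns the left side into a count of triples (g, x, y),
   which [torus_conj] sends to pairs (x, P). *)
move=> SLH /subsetP AH c_root; rewrite -(leq_pmul2l (torus_gt0 w)).
apply: leq_trans (torus_norm_coset_bound w SLH c_root); rewrite mulnC -cardsX.
apply: (@leq_card_rel _ _ _ _ (fun gxy xP =>
  (xP.1 == gxy.1.2) &&
  (torus_conj (GLval gxy.1.1) gxy.1.2 gxy.2 == map_mx iota (GLval xP.2)))).
  case=> [[g x] y]; rewrite in_setX inE /= => /andP[/and3P[gA gx xw] yw].
  have [P uP DP] := torus_conj_descent gx xw yw.
  exists (x, Sub P uP); last by rewrite /= eqxx DP /= eqxx.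
  rewrite inE /= xw; apply/exists_inP; exists g; first exact: AH.
  have [x_inj ex] := ordered_spectrumP _ _ gx.
  by rewrite -(det_eigenvalues x_inj ex) det_map_mx.
case=> [[g x] y] [[g' x'] y'] [x'' P]; rewrite !in_setX /=.
rewrite inE => /andP[/and3P[_ /= gx xw] /torusP yw].
rewrite inE => /andP[/and3P[_ /= gx' _] _].
move=> /andP[/eqP-> /eqP DP] /andP[/eqP Dx /eqP DP']; subst x'.
have [|Dg ->] := torus_conj_inj gx gx' _ (etrans DP (esym DP')).
- by move=> i; case: (yw i).
by congr (_, _, _); apply: val_inj.
Qed.

End FrobeniusType.

(** * Summation over permutations and the bound on proportions *)

Lemma regular_semisimple_count (F : finFieldType) (n k : nat)
    (H : {group {'GL_n.+1[F]}}) :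
  SL n.+1 F \subset H ->
  (#|[set g in H | regular_semisimple g && fixes_kspace k g]| * (n.+1)`!
    <= #|[set s : 'S_n.+1 | fixes_kset k s &&
           (#|fixed_points s| <= #|F| - 1)]| * #|H|)%N.
Proof.
move=> SLH; set A := [set g in H | _]; set W := [set s | _].
(* This size admits both the polynomials X^e - c with e at most q^(n+1) and the characteristic
   polynomials, of degree n+1 < q^(n+1). *)
have [K [iota splitK]] := finite_splitting_field F (#|F| ^ n.+1).+1.
have [phi phiE] := expf_card_rmorphism iota.
have c_root e : (0 < e)%N -> (e <= #|F| ^ n.+1)%N ->
    forall c, exists t, t ^+ e = iota c.
  move=> e_gt0 le_e c.
  have [||rs Drs] := splitK ('X^e - c%:P).
  - by rewrite -size_poly_eq0 size_XnsubC.
  - by rewrite size_XnsubC.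
  have size_rs : size rs = e.
    have := eqp_size Drs.
    by rewrite size_map_poly size_XnsubC // size_prod_XsubC => -[].
  case: rs size_rs Drs => [|t rs _ Drs].
    by move=> e0; rewrite -e0 in e_gt0.
  exists t; apply/eqP; rewrite -subr_eq0.
  have : root (map_poly iota ('X^e - c%:P)) t.
    by rewrite (eqp_root Drs) big_cons rootM root_XsubC eqxx.
  by rewrite rmorphB /= map_polyXn map_polyC rootE !hornerE.
have xP (g : {'GL_n.+1[F]}) : exists x : {ffun 'I_n.+1 -> K},
    g \in A -> ordered_spectrum iota (GLval g) x.
  have [|_] := boolP (g \in A); last by exists [ffun=> 0].
  rewrite inE => /and3P[_ /asboolP sqf_g _].
  have [||rs Drs] := splitK (char_poly (GLval g)).
  - by rewrite monic_neq0 ?char_poly_monic.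
  - by rewrite size_char_poly ltnS ltnW // ltn_expl // finNzRing_gt1.
  by have [x] := ordered_spectrum_exists sqf_g Drs; exists x.
have [x Dx] := fin_all_exists xP.
pose B w := [set gx : {'GL_n.+1[F]} * {ffun 'I_n.+1 -> K} |
  [&& gx.1 \in A, ordered_spectrum iota (GLval gx.1) gx.2 &
      gx.2 \in torus phi w]].
have AH : A \subset H by apply/subsetP => g; rewrite inE => /andP[].
have card_B w : (#|B w| <= #|H|)%N by apply: spectrum_count_bound.
apply: (@leq_trans #|\bigcup_(w in W) B w|); last first.
  rewrite -sum_nat_const; elim/big_rec2: _ => [|w a C _ le_C].
    by rewrite cards0.
  by rewrite (leq_trans (leq_card_setU _ _)) // leq_add.
have -> : (n.+1)`! = #|[set: 'S_n.+1]| by rewrite cardsT card_Sn.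
rewrite -cardsX.
(* Each [g] in [A] is paired with all reorderings of one chosen spectrum [x g]; these are distinct
   because [x g] is injective. *)
pose r (gs : {'GL_n.+1[F]} * 'S_n.+1)
    (gy : {'GL_n.+1[F]} * {ffun 'I_n.+1 -> K}) :=
  (gy.1 == gs.1) && (gy.2 == [ffun i => x gs.1 (gs.2 i)]).
apply: (@leq_card_rel _ _ _ _ r).
  case=> g s; rewrite in_setX => /andP[/= gA _].
  exists (g, [ffun i => x g (s i)]); last by rewrite /r /= !eqxx.
  have gy := ordered_spectrum_perm s (Dx _ gA).
  have [w yw] := spectrum_perm phiE (GL_unitmx g) gy.
  apply/bigcupP; exists w; last by rewrite inE; apply/and3P.
  have [y_inj _] := ordered_spectrumP _ _ _ gy.
  rewrite inE (torus_fixed_points iota phiE y_inj yw) andbT.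
  move: gA; rewrite inE => /and3P[_ _ /existsP[U /andP[/eqP <- Ug]]].
  (* [row_base] replaces the square matrix [U] of rank k by a row-free one with k rows and the same
     row space. *)
  apply: (torus_fixes_kset phiE gy yw (row_base_free U)).
  by rewrite stablemx_row_base.
case=> [g s] [g' s'] [h y]; rewrite !in_setX => /andP[/= gA _] _.
move=> /andP[/= /eqP-> /eqP->] /andP[/= /eqP<- /eqP E]; congr (_, _).
apply/permP => i; have [x_inj _] := ordered_spectrumP _ _ _ (Dx _ gA).
apply: x_inj; have := congr1 (fun f : {ffun 'I_n.+1 -> K} => f i) E.
by rewrite !ffunE.
Qed.

Theorem theorem5p1 (F : finFieldType) (q n k : nat) (hq : #|F| = q)
    (hk1 : (1 <= k)%N) (hkn : (k <= n./2)%N)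
    (H : {group {'GL_n[F]}}) (hSL : SL n F \subset H) :
  proportion H (fun g => regular_semisimple g && fixes_kspace k g)
    <= proportion [set: 'S_n] (fun s => fixes_kset k s)
  /\
  proportion H (fun g => regular_semisimple g && fixes_kspace k g)
    <= proportion [set: 'S_n]
         (fun s => fixes_kset k s && (#|fixed_points s| <= q - 1)%N).
Proof.
(* For n = 0 the matrices would have size 1, not n; the bounds on [k] exclude this case. *)
case: n H hkn hSL => [|n] H hkn hSL; first by rewrite leqNgt hk1 in hkn.
suff le_fix : proportion H (fun g => regular_semisimple g && fixes_kspace k g)
    <= proportion [set: 'S_n.+1]
         (fun s => fixes_kset k s && (#|fixed_points s| <= q - 1)%N).
  split=> //; apply: le_trans le_fix _.
  rewrite /proportion ler_wpM2r ?invr_ge0 ?ler0n // ler_nat subset_leq_card //.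
  by apply/subsetP => s; rewrite !inE /= => /andP[].
rewrite /proportion ler_pdivlMr ?ltr0n ?cardsT ?card_Sn ?fact_gt0 //.
rewrite mulrAC ler_pdivrMr ?ltr0n ?cardG_gt0 // -!natrM ler_nat.
apply: leq_trans (regular_semisimple_count k hSL) _; rewrite -hq leq_mul2r.
by apply/orP; right; apply: subset_leq_card; apply/subsetP => s; rewrite !inE.
Qed.
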